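(* Let $S$ be a positive semifield. Then the canonical weak lifting of the powerset monad $\mathcal P$ to the category $\mathrm{EM}(\mathbb S)$ of Eilenberg–Moore algebras of the semimodule monad $\mathbb S$, determined by the canonical weak distributive law $\delta \colon \mathbb S\mathcal P \to \mathcal P\mathbb S$, consists of the monad $(\tilde{\mathcal P},\eta^{\tilde{\mathcal P}},\mu^{\tilde{\mathcal P}})$ on $\mathrm{EM}(\mathbb S)$ given by (i) on objects: $\tilde{\mathcal P}(X,a) = (\mathcal P_c^a X, \alpha_a)$, where $\mathcal P_c^a X$ is the set of convex subsets of $X$ with respect to $a$ and $\alpha_a \colon \mathbb S(\mathcal P_c^a X) \to \mathcal P_c^a X$ is $\alpha_a(\Phi) = \{ a(\phi) \mid \phi \in c(\Phi)\}$; (ii) on morphisms $f\colon (X,a)\to(X',a')$: $\tilde{\mathcal P}(f)(A) = \mathcal P f(A) = \{f(x)\mid x\in A\}$ for $A\in\mathcal P_c^a X$; (iii) unit and multiplication: $\eta^{\tilde{\mathcal P}}_{(X,a)}(x) = \{x\}$ and $\mu^{\tilde{\mathcal P}}_{(X,a)}(\mathcal A) = \bigcup_{A\in\mathcal A} A$ for $x\in X$ and $\mathcal A \in \mathcal P_c^{\alpha_a}(\mathcal P_c^a X)$; together with the natural transformations $\iota \colon U^{\mathbb S}\tilde{\mathcal P} \to \mathcal P U^{\mathbb S}$ and $\pi \colon \mathcal P U^{\mathbb S} \to U^{\mathbb S}\tilde{\mathcal P}$ given by $\iota_{(X,a)}(A) = A$ (the inclusion $\mathcal P_c^a X \hookrightarrow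 \mathcal P X$) and $\pi_{(X,a)}(B) = \overline{B}^a$ (the convex closure of $B \subseteq X$ in $(X,a)$).
   Context: $S$ is a semiring $(S,+,\cdot,0,1)$; it is positive if $a+b=0$ implies $a=b=0$, and a semifield if every $a\neq 0$ has a two-sided multiplicative inverse. The semimodule monad $\mathbb S$ on $\mathbf{Set}$: $\mathbb S X$ is the set of functions $\phi\colon X\to S$ with finite support $\mathrm{supp}\,\phi=\{x\mid \phi(x)\neq 0\}$; $\mathbb S(f)(\phi)(y)=\sum_{x\in f^{-1}\{y\}}\phi(x)$; the unit sends $x$ to the Dirac function $\Delta_x$; the multiplication is $\mu^{\mathbb S}_X(\Psi)(x)=\sum_{\phi\in\mathrm{supp}\,\Psi}\Psi(\phi)\cdot\phi(x)$. Its Eilenberg–Moore algebras $(X,a\colon \mathbb S X\to X)$ are exactly left $S$-semimodules, and $U^{\mathbb S}\colon \mathrm{EM}(\mathbb S)\to\mathbf{Set}$ is the forgetful functor. $\mathcal P$ is the powerset monad (unit $x\mapsto\{x\}$, multiplication union). For an $\mathbb S$-algebra $(X,a)$ and $A\subseteq X$, the convex closure is $\overline{A}^a=\{a(\phi)\mid \phi\in\mathbb S X,\ \mathrm{supp}\,\phi\subseteq A,\ \sum_{x}\phi(x)=1\}$, $A$ is convex iff $A=\overline{A}^a$, and $\mathcal P_c^a X$ denotes the set of convex subsets (including $\emptyset$). For $\Phi\in\mathbb S\mathcal P X$, $c(\Phi)=\{\mathbb S(u)(\Phi)\mid u\colon \mathrm{supp}\,\Phi\to X,\ u(A)\in A \text{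 for all } A\in\mathrm{supp}\,\Phi\}$. For a positive semifield $S$, the canonical weak distributive law (the one arising from the unique locally monotone extension of $\mathbb S$ and $\mu^{\mathbb S}$ to the category of relations) is $\delta_X(\Phi)=\overline{c(\Phi)}^{\mu^{\mathbb S}_X}$, the convex closure of $c(\Phi)$ in $(\mathbb S X,\mu^{\mathbb S}_X)$. A weak distributive law $\delta\colon TS\to ST$ satisfies the distributive-law axioms except the one involving the unit of $T$. A weak lifting of $\mathcal P$ to $\mathrm{EM}(\mathbb S)$ is a monad $(\tilde{\mathcal P},\eta^{\tilde{\mathcal P}},\mu^{\tilde{\mathcal P}})$ on $\mathrm{EM}(\mathbb S)$ with natural transformations $\iota\colon U^{\mathbb S}\tilde{\mathcal P}\to\mathcal P U^{\mathbb S}$, $\pi\colon\mathcal P U^{\mathbb S}\to U^{\mathbb S}\tilde{\mathcal P}$ with $\pi\iota=\mathrm{id}$, compatible with units and multiplications; since idempotents split in $\mathbf{Set}$, weak distributive laws $\mathbb S\mathcal P\to\mathcal P\mathbb S$ correspond bijectively to weak liftings of $\mathcal P$ to $\mathrm{EM}(\mathbb S)$. *)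

(* Defs.v *)
From mathcomp Require Import all_boot all_algebra finmap.
From mathcomp Require Import boolp classical_sets functions cardinality fsbigop.

Set Implicit Arguments.
Unset Strict Implicit.
Unset Printing Implicit Defensive.
Import GRing.Theory.
Local Open Scope classical_set_scope.
Local Open Scope ring_scope.

Record category := Category {
  Ob :> Type;
  Mor : Ob -> Ob -> Type;
  idm : forall X, Mor X X;
  cmp : forall X Y Z, Mor Y Z -> Mor X Y -> Mor X Z;
  cmp_idl : forall X Y (f : Mor X Y), cmp (idm Y) f = f;
  cmp_idr : forall X Y (f : Mor X Y), cmp f (idm X) = f;
  cmpA : forall X Y Z W (h : Mor Z W) (g : Mor Y Z) (f : Mor X Y),
    cmp h (cmp g f) = cmp (cmp h g) f }.
Arguments idm {c} X.
Arguments cmp {c X Y Z} g f.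
Notation "g ∘ f" := (cmp g f) (at level 40, left associativity).

Section FunctorsMonads.
Variables (C D : category).

Definition is_functor (Fo : C -> D)
    (Fm : forall X Y, Mor X Y -> Mor (Fo X) (Fo Y)) : Prop :=
  (forall X, Fm X X (idm X) = idm (Fo X)) /\
  (forall X Y Z (g : Mor Y Z) (f : Mor X Y),
     Fm X Z (g ∘ f) = Fm Y Z g ∘ Fm X Y f).

Definition is_natural (Fo Go : C -> D)
    (Fm : forall X Y, Mor X Y -> Mor (Fo X) (Fo Y))
    (Gm : forall X Y, Mor X Y -> Mor (Go X) (Go Y))
    (t : forall X, Mor (Fo X) (Go X)) : Prop :=
  forall X Y (f : Mor X Y), t Y ∘ Fm X Y f = Gm X Y f ∘ t X.

End FunctorsMonads.

Definition is_monad (C : category) (To : C -> C)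
    (Tm : forall X Y, Mor X Y -> Mor (To X) (To Y))
    (eta : forall X, Mor X (To X)) (mu : forall X, Mor (To (To X)) (To X))
    : Prop :=
  [/\ is_functor Tm,
      is_natural (fun X Y f => f) Tm eta,
      is_natural (fun X Y f => Tm _ _ (Tm X Y f)) Tm mu,
      (forall X, mu X ∘ eta (To X) = idm (To X)) /\
      (forall X, mu X ∘ Tm _ _ (eta X) = idm (To X))
    & forall X, mu X ∘ Tm _ _ (mu X) = mu X ∘ mu (To X)].

Record monad (C : category) := Monad {
  mob :> C -> C;
  mmap : forall X Y, Mor X Y -> Mor (mob X) (mob Y);
  munit : forall X, Mor X (mob X);
  mmult : forall X, Mor (mob (mob X)) (mob X);
  monadP : is_monad mmap munit mmult }.
Arguments mmap {C} m {X Y} f.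
Arguments munit {C} m X.
Arguments mmult {C} m X.

Definition SET : category :=
  @Category Type (fun X Y => X -> Y) (fun X x => x)
    (fun X Y Z g f x => g (f x))
    (fun X Y f => erefl) (fun X Y f => erefl) (fun X Y Z W h g f => erefl).

Section EilenbergMoore.
Variable T : monad SET.

Definition is_algebra (X : Type) (a : T X -> X) : Prop :=
  (forall x, a (munit T X x) = x) /\
  (forall t, a (mmap T (X := T X) (Y := X) a t) = a (mmult T X t)).

Record algebra := Algebra {
  carrier :> Type;
  act : T carrier -> carrier;
  algebraP : is_algebra act }.

Record algebra_hom (A B : algebra) := AlgebraHom {
  hom_fun :> A -> B;
  hom_act : forall t,
    hom_fun (act t) = act (mmap T (X := A) (Y := B) hom_fun t) }.

Lemma algebra_hom_eq (A B : algebra) (f g : algebra_hom A B) :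
  hom_fun f = hom_fun g -> f = g.
Proof.
case: f g => f Hf [g Hg] /= E; case: _ / E Hg => Hg.
by rewrite (Prop_irrelevance Hf Hg).
Qed.

Lemma hom_id_act (A : algebra) (t : T A) :
  act t = act (mmap T (X := A) (Y := A) id t).
Proof. by case: (monadP T) => -[/(_ A) /= -> _]. Qed.

Lemma hom_comp_act (A B C : algebra) (g : algebra_hom B C)
    (f : algebra_hom A B) (t : T A) :
  g (f (act t)) = act (mmap T (X := A) (Y := C) (fun x => g (f x)) t).
Proof.
case: (monadP T) => -[_ /(_ A B C g f) /= ->] _ _ _ _.
by rewrite !hom_act.
Qed.

Definition EMcat : category.
Proof.
apply: (@Category algebra algebra_hom
  (fun A => AlgebraHom (@hom_id_act A))
  (fun A B C g f => AlgebraHom (hom_comp_act g f))).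
- by move=> X Y f; exact: algebra_hom_eq.
- by move=> X Y f; exact: algebra_hom_eq.
- by move=> X Y Z W h g f; exact: algebra_hom_eq.
Defined.

Definition U0 (A : EMcat) : SET := carrier A.
Definition U1 (A B : EMcat) (f : Mor A B) : Mor (U0 A) (U0 B) := hom_fun f.

Definition free_alg (X : Type) : EMcat.
Proof.
apply: (@Algebra (T X) (mmult T X)); split=> t;
  case: (monadP T) => _ _ _ [muL muR] muA.
- exact: (congr1 (fun h : T X -> T X => h t) (muL X)).
- exact: (congr1 (fun h : T (T (T X)) -> T X => h t) (muA X)).
Defined.

End EilenbergMoore.
Arguments U0 {T} A.
Arguments U1 {T A B} f.

Section WeakLaws.
Variables (T P : monad SET).

Definition weak_distributive_law
    (d : forall X : SET, Mor (T (P X)) (P (T X))) : Prop :=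
  [/\ is_natural (fun X Y f => mmap T (mmap P f))
                 (fun X Y f => mmap P (mmap T f)) d,
      forall X, d X ∘ mmap T (munit P X) = munit P (T X),
      forall X, d X ∘ mmult T (P X)
                = mmap P (mmult T X) ∘ d (T X) ∘ mmap T (d X)
    & forall X, d X ∘ mmap T (mmult P X)
                = mmult P (T X) ∘ mmap P (d X) ∘ d (P X)].

Section Liftings.
Variables (Qo : EMcat T -> EMcat T)
  (Qm : forall X Y : EMcat T, Mor X Y -> Mor (Qo X) (Qo Y))
  (eta : forall X, Mor X (Qo X)) (mu : forall X, Mor (Qo (Qo X)) (Qo X))
  (iota : forall X : EMcat T, Mor (U0 (Qo X)) (P (U0 X)))
  (pi : forall X : EMcat T, Mor (P (U0 X)) (U0 (Qo X))).
Arguments iota X : clear implicits.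
Arguments pi X : clear implicits.

Definition is_weak_lifting : Prop :=
  [/\ is_monad Qm eta mu,
      is_natural (fun X Y f => U1 (Qm f)) (fun X Y f => mmap P (U1 f)) iota
      /\
      is_natural (fun X Y f => mmap P (U1 f)) (fun X Y f => U1 (Qm f)) pi,
      forall X, pi X ∘ iota X = idm (U0 (Qo X)),
      (forall X, iota X ∘ U1 (eta X) = munit P (U0 X)) /\
      (forall X, iota X ∘ U1 (mu X)
                 = mmult P (U0 X) ∘ mmap P (iota X) ∘ iota (Qo X))
    & (forall X, pi X ∘ munit P (U0 X) = U1 (eta X)) /\
      (forall X, pi X ∘ mmult P (U0 X)
                 = U1 (mu X) ∘ pi (Qo X) ∘ mmap P (pi X))].

Variable d : forall X : SET, Mor (T (P X)) (P (T X)).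
Arguments d X : clear implicits.

(* The construction of a lifting from a law: [iota] and [pi] split the
   idempotent P a ∘ d ∘ eta^T on P X, and the action on the splitting is
   pi ∘ P a ∘ d ∘ T iota. The action on morphisms, the unit and the
   multiplication are then forced by [is_weak_lifting], since iota is monic. *)
Definition splits_law : Prop :=
  forall X : EMcat T,
    let a : Mor (T (U0 X)) (U0 X) := act (a := X) in
    iota X ∘ pi X = mmap P a ∘ d (U0 X) ∘ munit T (P (U0 X)) /\
    (act (a := Qo X) : Mor (T (U0 (Qo X))) (U0 (Qo X)))
    = pi X ∘ mmap P a ∘ d (U0 X) ∘ mmap T (iota X).

(* The inverse construction, of a law from a lifting. *)
Definition induces_law : Prop :=
  forall X : SET,
    let F := free_alg T X in
    d X = iota F ∘ (act (a := Qo F) : Mor (T (U0 (Qo F))) (U0 (Qo F)))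
          ∘ mmap T (pi F) ∘ mmap T (mmap P (munit T X)).

End Liftings.
End WeakLaws.

Lemma powerset_monadP :
  @is_monad SET (fun X => set X) (fun X Y f A => f @` A)
    (fun X x => [set x]) (fun X AA => \bigcup_(A in AA) A).
Proof.
split; [split| | |split|] => /=.
- by move=> X; apply/funext => A /=; rewrite image_id.
- by move=> X Y Z g f; apply/funext => A /=; rewrite -image_comp.
- by move=> X Y f; apply/funext => x /=; rewrite image_set1.
- move=> X Y f; apply/funext => AA; apply/seteqP; split => y /=.
  + by case=> _ [A AAA <-] [x Ax <-]; exists x => //; exists A.
  + by case=> x [A AAA Ax] <-; exists (f @` A); [exists A|exists x].
- by move=> X; apply/funext => A /=; rewrite bigcup_set1.
- move=> X; apply/funext => A; apply/seteqP; split => y /=.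
  + by case=> _ [x Ax <-] ->.
  + by move=> Ay; exists [set y] => //; exists y.
- move=> X; apply/funext => AAA; apply/seteqP; split => y /=.
  + by case=> _ [AA HAA <-] [A HA Ay]; exists A => //; exists AA.
  + by case=> A [AA HAA HA] Ay; exists (\bigcup_(B in AA) B); [exists AA|exists A].
Qed.

Definition Powerset : monad SET := Monad powerset_monadP.

Definition graph (X Y : Type) (f : X -> Y) : X -> Y -> Prop :=
  fun x y => f x = y.
Definition rel_comp (X Y Z : Type) (R : X -> Y -> Prop) (Q : Y -> Z -> Prop) :
  X -> Z -> Prop := fun x z => exists2 y, R x y & Q y z.

Section Canonical.
Variable T : monad SET.

(* A locally monotone functor Rel -> Rel extending T, for which the
   multiplication of T stays natural. Preservation of identities is the case
   f = id of the first clause. *)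
Definition locally_monotone_extension
    (E : forall X Y : Type, (X -> Y -> Prop) -> T X -> T Y -> Prop) : Prop :=
  [/\ forall (X Y : Type) (f : X -> Y),
        E X Y (graph f) = graph (mmap T (X := X) (Y := Y) f),
      forall (X Y Z : Type) (R : X -> Y -> Prop) (Q : Y -> Z -> Prop),
        E X Z (rel_comp R Q) = rel_comp (E X Y R) (E Y Z Q),
      forall (X Y : Type) (R Q : X -> Y -> Prop),
        (forall x y, R x y -> Q x y) ->
        forall s t, E X Y R s t -> E X Y Q s t
    & forall (X Y : Type) (R : X -> Y -> Prop),
        rel_comp (E (T X) (T Y) (E X Y R)) (graph (mmult T Y))
        = rel_comp (graph (mmult T X)) (E X Y R)].

Definition canonical_law (d : forall X : Type, T (set X) -> set (T X)) :
    Prop :=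
  exists E, unique locally_monotone_extension E /\
    forall (X : Type) (t : T (set X)),
      d X t = [set s | E (set X) X (fun A x => A x) t s].

End Canonical.

Definition positive_semiring (S : pzSemiRingType) : Prop :=
  forall a b : S, a + b = 0 -> a = 0 /\ b = 0.

Definition semifield (S : pzSemiRingType) : Prop :=
  forall a : S, a <> 0 -> exists b : S, a * b = 1 /\ b * a = 1.

Section Semimodules.
Variable S : pzSemiRingType.

Record fsfunc (X : Type) := FsFunc {
  fsf :> X -> S;
  fsfP : finite_set [set x | fsf x <> 0] }.

Definition supp (X : Type) (phi : fsfunc X) : set X := [set x | phi x <> 0].

Lemma fsfunc_eq (X : Type) (phi psi : fsfunc X) :
  (forall x, phi x = psi x) -> phi = psi.
Proof.
case: phi psi => f Hf [g Hg] /= /funext E.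
by case: _ / E Hg => Hg; rewrite (Prop_irrelevance Hf Hg).
Qed.

Definition smap_fun (X Y : Type) (f : X -> Y) (phi : fsfunc X) (y : Y) : S :=
  \sum_(x \in (f @^-1` [set y] : set {classic X})) phi x.

Definition smult_fun (X : Type) (Psi : fsfunc (fsfunc X)) (x : X) : S :=
  \sum_(phi \in (supp Psi : set {classic fsfunc X})) Psi phi * phi x.

Definition dirac_fun (X : Type) (x y : X) : S :=
  if (x == y :> {classic X}) then 1 else 0.

Definition total_weight (X : Type) (phi : fsfunc X) : S :=
  \sum_(x \in [set: {classic X}]) phi x.

Definition integral (X : Type) (phi : fsfunc X) (h : X -> S) : S :=
  \sum_(x <- (fset_set (supp phi : set {classic X}) : seq {classic X}))
    phi x * h x.

Lemma mem_supp (X : Type) (phi : fsfunc X) (x : {classic X}) :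
  (x \in fset_set (supp phi : set {classic X})) = (phi x != 0).
Proof.
rewrite in_fset_set; last exact: fsfP.
by apply/idP/idP => [|/eqP H]; [rewrite inE => /eqP|rewrite inE].
Qed.

Lemma integralE (X : Type) (phi : fsfunc X) (h : X -> S)
    (K : seq {classic X}) :
  uniq K -> (forall x : {classic X}, phi x <> 0 -> x \in K) ->
  integral phi h = \sum_(x <- K) phi x * h x.
Proof.
move=> uK HK; rewrite /integral.
rewrite [RHS](bigID (fun x => phi x != 0)) /= addrC.
rewrite [X in _ = X + _]big1 ?add0r; last first.
  by move=> i; rewrite negbK => /eqP ->; rewrite mul0r.
rewrite -[RHS]big_filter; apply: perm_big; apply: uniq_perm.
- exact: fset_uniq.
- exact: filter_uniq.
- move=> x; rewrite mem_filter mem_supp.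
  by case: eqP => //= /HK ->.
Qed.

Lemma fsum_integral (X : Type) (phi : fsfunc X) (D : set {classic X})
    (F h : X -> S) :
  (forall x, D x -> F x = phi x * h x) -> (forall x, ~ D x -> h x = 0) ->
  \sum_(x \in D) F x = integral phi h.
Proof.
move=> HF Hh.
rewrite (eq_fsbigr (fun x : {classic X} => phi x * h x)); last first.
  by move=> x /set_mem; exact: HF.
rewrite (@fsbig_widen {classic X} S 0 +%R D setT) //; last first.
  by move=> x [_ /= nD]; rewrite Hh ?mulr0.
rewrite fsbig_supp setTI.
rewrite (@fsbig_widen {classic X} S 0 +%R _ (supp phi)); first last.
- by move=> x [_ /= /contrapT].
- by move=> x /= H E; apply: H; rewrite E mul0r.
by rewrite fsbig_finite //; exact: fsfP.
Qed.

Lemma smap_integral (X Y : Type) (f : X -> Y) (phi : fsfunc X) y :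
  smap_fun f phi y = integral phi (fun x => dirac_fun (f x) y).
Proof.
apply: fsum_integral => x /=; rewrite /dirac_fun.
- by move=> ->; rewrite eqxx /= mulr1.
- by case: eqP.
Qed.

Lemma smult_integral (X : Type) (Psi : fsfunc (fsfunc X)) x :
  smult_fun Psi x = integral Psi (fun phi => phi x).
Proof.
rewrite /smult_fun /integral fsbig_finite //; exact: fsfP.
Qed.

Lemma total_weight_integral (X : Type) (phi : fsfunc X) :
  total_weight phi = integral phi (fun _ => 1).
Proof. by apply: fsum_integral => x; [rewrite mulr1|case]. Qed.

Lemma integral_neq0 (X : Type) (phi : fsfunc X) (h : X -> S) :
  integral phi h <> 0 -> exists2 x, supp phi x & h x <> 0.
Proof.
move=> H; apply: contrapT => nex; apply: H; rewrite /integral big_seq big1 //.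
move=> x; rewrite mem_supp => /eqP phix.
have [->|/eqP hx] := eqVneq (h x) 0; first by rewrite mulr0.
by exfalso; apply: nex; exists x.
Qed.

Lemma dirac_fin (X : Type) (x : X) : finite_set [set y | dirac_fun x y <> 0].
Proof.
apply: (@sub_finite_set _ _ [set x]); last exact: finite_set1.
by move=> y /=; rewrite /dirac_fun; case: eqP.
Qed.

Definition dirac (X : Type) (x : X) : fsfunc X := FsFunc (dirac_fin x).

Lemma smap_fin (X Y : Type) (f : X -> Y) (phi : fsfunc X) :
  finite_set [set y | smap_fun f phi y <> 0].
Proof.
apply: (@sub_finite_set _ _ (f @` supp phi)); last first.
  exact/finite_image/fsfP.
move=> y /=; rewrite smap_integral => /integral_neq0 [x sx].
by rewrite /dirac_fun; case: eqP => // <- _; exists x.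
Qed.

Definition smap (X Y : Type) (f : X -> Y) (phi : fsfunc X) : fsfunc Y :=
  FsFunc (smap_fin f phi).

Lemma smult_fin (X : Type) (Psi : fsfunc (fsfunc X)) :
  finite_set [set x | smult_fun Psi x <> 0].
Proof.
apply: (@sub_finite_set _ _ (\bigcup_(phi in supp Psi) supp phi)).
  by move=> x /=; rewrite smult_integral => /integral_neq0 [phi]; exists phi.
by apply: bigcup_finite => [|phi _]; exact: fsfP.
Qed.

Definition smult (X : Type) (Psi : fsfunc (fsfunc X)) : fsfunc X :=
  FsFunc (smult_fin Psi).

Lemma sum_dirac (X : Type) (K : seq {classic X}) (x : X) (h : X -> S) :
  uniq K -> (x : {classic X}) \in K ->
  \sum_(y <- K) dirac_fun x y * h y = h x.
Proof.
move=> uK xK; rewrite (bigD1_seq (x : {classic X})) //= big1 ?addr0.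
  by rewrite /dirac_fun eqxx mul1r.
by move=> y yx; rewrite /dirac_fun eq_sym (negPf yx) mul0r.
Qed.

Lemma integral_dirac (X : Type) (x : X) (h : X -> S) :
  integral (dirac x) h = h x.
Proof.
rewrite (@integralE _ _ _ [:: x : {classic X}]) //.
  by rewrite big_seq1 /= /dirac_fun eqxx mul1r.
by move=> y /=; rewrite /dirac_fun inE eq_sym; case: (_ == _).
Qed.

Lemma integral_ev (X : Type) (phi : fsfunc X) (x : X) :
  integral phi (fun y => dirac_fun y x) = phi x.
Proof.
pose K : seq {classic X} := undup
  ((x : {classic X}) :: fset_set (supp phi : set {classic X})).
have KE (y : {classic X}) : (y \in K) = (y == x) || (phi y != 0).
  by rewrite /K mem_undup inE mem_supp.
rewrite (@integralE _ _ _ K); [|exact: undup_uniq|]; last first.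
  by move=> y /eqP H; rewrite KE H orbT.
rewrite (bigD1_seq (x : {classic X})) ?KE ?eqxx ?undup_uniq //=.
rewrite big1 ?addr0 /dirac_fun ?eqxx ?mulr1 // => y yx.
by rewrite (negPf yx) mulr0.
Qed.

Lemma integral_ext (X : Type) (phi : fsfunc X) (g h : X -> S) :
  (forall x, g x = h x) -> integral phi g = integral phi h.
Proof. by move=> E; congr integral; exact/funext. Qed.

Lemma integral_smap (X Y : Type) (f : X -> Y) (phi : fsfunc X) (h : Y -> S) :
  integral (smap f phi) h = integral phi (fun x => h (f x)).
Proof.
pose K : seq {classic Y} :=
  undup (map (f : {classic X} -> {classic Y})
    (fset_set (supp phi : set {classic X}))).
rewrite (@integralE _ _ _ K) ?undup_uniq //; last first.
  move=> y /=; rewrite smap_integral => /integral_neq0 [x /eqP sx].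
  rewrite /dirac_fun; case: eqP => // <- _; rewrite /K mem_undup.
  by apply: map_f; rewrite mem_supp.
under eq_bigr => y _ do rewrite /= smap_integral /integral mulr_suml.
rewrite exchange_big /= /integral; apply: eq_big_seq => x xs.
under eq_bigr do rewrite -mulrA.
rewrite -mulr_sumr sum_dirac ?undup_uniq //.
by rewrite /K mem_undup; exact: map_f.
Qed.

Lemma integral_smult (X : Type) (Psi : fsfunc (fsfunc X)) (h : X -> S) :
  integral (smult Psi) h = integral Psi (fun phi => integral phi h).
Proof.
pose L : seq {classic fsfunc X} :=
  fset_set (supp Psi : set {classic fsfunc X}).
pose E (phi : {classic fsfunc X}) : seq {classic X} :=
  fset_set (supp phi : set {classic X}).
pose K : seq {classic X} := undup (flatten (map E L)).
have HK (phi : {classic fsfunc X}) : phi \in L ->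
    forall x : {classic X}, fsf phi x <> 0 -> x \in K.
  move=> phiL x /eqP phix; rewrite /K mem_undup; apply/flatten_mapP.
  by exists phi; rewrite // /E mem_supp.
rewrite (@integralE _ _ _ K) ?undup_uniq //; last first.
  move=> x /=; rewrite smult_integral => /integral_neq0 [phi /eqP sphi].
  by apply: HK; rewrite mem_supp.
under eq_bigr => y _ do rewrite /= smult_integral /integral mulr_suml.
rewrite exchange_big /= /integral -/L; apply: eq_big_seq => phi phiL.
under eq_bigr do rewrite -mulrA.
rewrite -mulr_sumr -integralE ?undup_uniq //.
exact: HK.
Qed.

Lemma semimodule_monadP : @is_monad SET fsfunc smap dirac smult.
Proof.
split; [split| | |split|] => /=.
- move=> X; apply/funext => phi; apply: fsfunc_eq => x /=.
  by rewrite smap_integral integral_ev.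
- move=> X Y Z g f; apply/funext => phi; apply: fsfunc_eq => z /=.
  by rewrite !smap_integral integral_smap.
- move=> X Y f; apply/funext => x; apply: fsfunc_eq => y /=.
  by rewrite smap_integral integral_dirac.
- move=> X Y f; apply/funext => Psi; apply: fsfunc_eq => y /=.
  rewrite smap_integral smult_integral integral_smult integral_smap.
  by apply: integral_ext => phi; rewrite /= smap_integral.
- move=> X; apply/funext => phi; apply: fsfunc_eq => x /=.
  by rewrite smult_integral integral_dirac.
- move=> X; apply/funext => phi; apply: fsfunc_eq => x /=.
  by rewrite smult_integral integral_smap integral_ev.
- move=> X; apply/funext => Th; apply: fsfunc_eq => x /=.
  rewrite !smult_integral integral_smap integral_smult.
  by apply: integral_ext => Psi; rewrite /= smult_integral.
Qed.

Definition Semimod : monad SET := Monad semimodule_monadP.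

Definition convex_closure (X : Type) (a : fsfunc X -> X) (A : set X) : set X :=
  [set a phi | phi in [set phi | supp phi `<=` A /\ total_weight phi = 1]].

Definition convex_sets (X : Type) (a : fsfunc X -> X) : set (set X) :=
  [set A | A = convex_closure a A].

Definition Pc (X : EMcat Semimod) : Type := convex_sets (act (a := X)).

Definition incl (X : EMcat Semimod) (A : Pc X) : set X := \val A.

Lemma restrict_fin (X : Type) (Phi : fsfunc X) :
  finite_set [set p : supp Phi | Phi (val p) <> 0].
Proof.
by apply: (@finite_preimage _ _ (supp Phi) val) => [p q _ _ /val_inj|]; [|exact: fsfP].
Qed.

(* Phi seen as a function on its own support, so that the choice functions in
   [choices] are only defined on supp Phi: a total choice function
   [set X -> X] need not exist when X is empty. *)
Definition restrict (X : Type) (Phi : fsfunc X) : fsfunc (supp Phi) :=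
  FsFunc (restrict_fin Phi).

Definition choices (X : Type) (Phi : fsfunc (set X)) : set (fsfunc X) :=
  [set phi | exists2 u : supp Phi -> X,
     (forall A : supp Phi, val A (u A)) & phi = smap u (restrict Phi)].

Definition delta (X : Type) (Phi : fsfunc (set X)) : set (fsfunc X) :=
  convex_closure (@smult X) (choices Phi).

End Semimodules.

(* Main.v *)
Require Import Defs.
From mathcomp Require Import all_boot all_algebra finmap.
From mathcomp Require Import boolp classical_sets cardinality.

(* Over a positive semifield, finitely supported weights can be conditioned:
   if w has first marginal phi, then w is obtained from phi by attaching to
   each x in its support the weights phi(x)^-1 * w(x,-), which sum to 1. Hence
   the square of two couplings with a common marginal, and the naturality
   squares of the multiplication, are weak pullbacks, so that relating s and t
   when they are the marginals of some w supported in R is a locally monotone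
   extension to relations; as relations are spans of functions, it is the only
   one. The law it induces is delta, because a coupling of Phi with phi
   supported in the membership relation is a family of conditional weights on
   the sets in supp Phi, and the product of these weights is a convex
   combination of choice functions. The weak lifting is governed by the maps
   D = P a ∘ delta : S P X -> P X, which satisfy D ∘ mu = D ∘ S D; the convex
   closure of B is D(Delta_B), and alpha_a is the restriction of D to convex
   sets. *)

Set Implicit Arguments.
Unset Strict Implicit.
Unset Printing Implicit Defensive.
Import GRing.Theory.
Local Open Scope classical_set_scope.
Local Open Scope ring_scope.

(** * Weak distributive laws *)

Definition membership (X : Type) : set X -> X -> Prop := fun A x => A x.

Section Extension.
Variables (T : monad SET)
  (E : forall X Y : Type, (X -> Y -> Prop) -> T X -> T Y -> Prop).
Hypothesis extE : locally_monotone_extension (@E).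
Arguments E {X Y}.

Lemma ext_graph (X Y : Type) (f : X -> Y) :
  E (graph f) = graph (mmap T (X := X) (Y := Y) f).
Proof. by case: extE. Qed.

Lemma ext_comp (X Y Z : Type) (R : X -> Y -> Prop) (Q : Y -> Z -> Prop) :
  E (rel_comp R Q) = rel_comp (E R) (E Q).
Proof. by case: extE. Qed.

Lemma ext_le (X Y : Type) (R Q : X -> Y -> Prop) :
  (forall x y, R x y -> Q x y) -> forall s t, E R s t -> E Q s t.
Proof. by case: extE => _ _ + _; exact. Qed.

Lemma ext_id (X : Type) (s t : T X) : E (graph (@id X)) s t = (s = t).
Proof. by rewrite ext_graph; case: (monadP T) => -[/(_ X) /= -> _]. Qed.

(* A function is left adjoint to its converse in the 2-category of relations,
   and locally monotone functors preserve adjunctions. *)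
Lemma ext_converse (X Y : Type) (f : X -> Y) (s : T Y) (t : T X) :
  E (fun y x => f x = y) s t <-> mmap T (X := X) (Y := Y) f t = s.
Proof.
split=> [Est|<-].
- have : E (rel_comp (fun y x => f x = y) (graph f)) s
            (mmap T (X := X) (Y := Y) f t).
    by rewrite ext_comp ext_graph; exists t.
  move/(@ext_le _ _ _ (graph (@id Y))).
  by rewrite ext_id => -> // y z [x <- <-].
- have : E (rel_comp (graph f) (fun y x => f x = y)) t t.
    apply: (@ext_le _ _ (graph id)); rewrite ?ext_id // => x _ <-.
    by exists (f x).
  by rewrite ext_comp ext_graph => -[_ <-].
Qed.

(** By [ext_comp] the composite factors through [T Z], and [ext_converse] forces its first factor;
    what remains mentions only [mmap T], not [E]. *)
Lemma ext_span (X Y Z : Type) (p : Z -> X) (q : Z -> Y) (s : T X) (t : T Y) :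
  E (rel_comp (fun x z => p z = x) (graph q)) s t <->
  exists2 w : T Z, mmap T (X := Z) (Y := X) p w = s
                 & mmap T (X := Z) (Y := Y) q w = t.
Proof.
rewrite ext_comp ext_graph; split=> -[w].
- by move=> /ext_converse wp wq; exists w.
- by move=> wp wq; exists w => //; apply/ext_converse.
Qed.

Definition law_of_ext (X : Type) (t : T (set X)) : set (T X) :=
  [set s | E (@membership X) t s].

(** Each axiom is an identity between composites of graphs and membership relations, carried through
    [E]: direct images give naturality, singletons the unit of the powerset, unions its
    multiplication. The axiom for the multiplication of [T] comes from the last clause of
    [locally_monotone_extension]. *)
Lemma weak_law_of_ext :
  weak_distributive_law (T := T) (P := Powerset) law_of_ext.
Proof.
(* The graph of a set-valued function followed by membership is the relation that the function
   transposes. *)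
have law_comp (X : Type) :
    rel_comp (graph (@law_of_ext X)) (@membership (T X)) = E (@membership X).
  apply/funext => t; apply/funext => s; apply/propext.
  by split=> [[_ <-]|Ets] //; exists (law_of_ext t).
split.
- move=> X Y f; apply/funext => t; apply/seteqP.
  have H : rel_comp (graph (fun A : set X => f @` A)) (@membership Y)
         = rel_comp (@membership X) (graph f).
    apply/funext => A; apply/funext => y; apply/propext.
    split=> [[_ <- [x]]|[x Ax fx]]; first by exists x.
    by exists (f @` A) => //; exists x.
  have := ext_comp (graph (fun A : set X => f @` A)) (@membership Y).
  rewrite H ext_comp !ext_graph => /(congr1 (@^~ t)) => Ht.
  split=> s /= Hs.
  + have : rel_comp (graph (mmap T (X := set X) (Y := set Y) (fun A => f @` A)))
      (E (@membership Y)) t s by eexists.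
    by rewrite -Ht => -[r tr <-]; exists r.
  + case: Hs => r tr <-.
    have : rel_comp (E (@membership X)) (graph (mmap T (X := X) (Y := Y) f)) t
            (mmap T (X := X) (Y := Y) f r) by exists r.
    by rewrite Ht => -[_ <-].
- move=> X; apply/funext => t /=.
  have H : rel_comp (graph (@set1 X)) (@membership X) = graph id.
    apply/funext => x; apply/funext => y; apply/propext.
    by split=> [[_ <- ->]|<-] //; exists [set x].
  apply/seteqP; split=> s /=.
  + move=> Hs.
    have : E (rel_comp (graph (@set1 X)) (@membership X)) t s.
      by rewrite ext_comp ext_graph; eexists.
    by rewrite H ext_id.
  + move=> ->.
    have : E (rel_comp (graph (@set1 X)) (@membership X)) t t.
      by rewrite H ext_id.
    by rewrite ext_comp ext_graph => -[_ <-].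
- move=> X; apply/funext => t /=.
  case: extE => _ _ _ /(_ _ _ (@membership X)).
  (* Factoring the inner [E (@membership X)] through [law_of_ext] turns its image under [E] into
     [mmap T] of the law, followed by the law. *)
  rewrite -{1}law_comp ext_comp ext_graph => H.
  apply/seteqP; split=> s /=.
  + move=> Hs.
    have : rel_comp (graph (mmult T (set X))) (E (@membership X)) t s.
      by eexists.
    by rewrite -H => -[r [_ <- tr] <-]; exists r.
  + move=> [r tr <-].
    have : rel_comp (rel_comp (graph (mmap T (X := T (set X)) (Y := set (T X))
        (@law_of_ext X))) (E (@membership (T X)))) (graph (mmult T X))
        t (mmult T X r).
      by exists r => //; eexists.
    by rewrite H => -[_ <-].
- move=> X; apply/funext => t /=.
  have H : rel_comp (graph (fun AA : set (set X) => \bigcup_(A in AA) A))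
      (@membership X) = rel_comp (@membership (set X)) (@membership X).
    apply/funext => AA; apply/funext => x; apply/propext.
    split=> [[_ <- [A AAA Ax]]|[A AAA Ax]]; first by exists A.
    by exists (\bigcup_(B in AA) B) => //; exists A.
  have {H} := congr1 (fun R => E R t) H.
  rewrite !ext_comp ext_graph => H.
  apply/seteqP; split=> s /=.
  + move=> Hs.
    have : rel_comp (graph (mmap T (X := set (set X)) (Y := set X)
        (fun AA : set (set X) => \bigcup_(A in AA) A))) (E (@membership X)) t s.
      by eexists.
    by rewrite H => -[r tr rs]; exists (law_of_ext r) => //; exists r.
  + move=> [_ [r tr <-] rs].
    have : rel_comp (E (@membership (set X))) (E (@membership X)) t s.
      by exists r.
    by rewrite -H => -[_ <-].
Qed.

End Extension.

(** * Semialgebras on powersets arising from a weak law *)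

Section WeakAction.
Variables (T : monad SET) (d : forall X : Type, T (set X) -> set (T X)).
Hypothesis dP : weak_distributive_law (T := T) (P := Powerset) d.
Arguments d {X}.

Definition tmap (X Y : Type) (f : X -> Y) : T X -> T Y :=
  mmap T (X := X) (Y := Y) f.

Lemma tmap_comp (X Y Z : Type) (g : Y -> Z) (f : X -> Y) (t : T X) :
  tmap g (tmap f t) = tmap (g \o f) t.
Proof.
by case: (monadP T) => -[_ /(_ _ _ _ g f) /(congr1 (@^~ t)) /esym].
Qed.

Lemma tmap_unit (X Y : Type) (f : X -> Y) (x : X) :
  tmap f (munit T X x) = munit T Y (f x).
Proof.
by case: (monadP T) => _ /(_ _ _ f) /(congr1 (@^~ x)) /esym.
Qed.

Lemma mult_unit (X : Type) (t : T X) : mmult T X (munit T (T X) t) = t.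
Proof. by case: (monadP T) => _ _ _ [/(_ X) /(congr1 (@^~ t))]. Qed.

Lemma mult_tmap_unit (X : Type) (t : T X) : mmult T X (tmap (munit T X) t) = t.
Proof. by case: (monadP T) => _ _ _ [_ /(_ X) /(congr1 (@^~ t))]. Qed.

Lemma law_image (X Y : Type) (f : X -> Y) (t : T (set X)) :
  d (tmap (fun A => f @` A) t) = tmap f @` d t.
Proof. by case: dP => /(_ _ _ f) /(congr1 (@^~ t)). Qed.

Lemma law_set1 (X : Type) (t : T X) : d (tmap set1 t) = [set t].
Proof. by case: dP => _ /(_ X) /(congr1 (@^~ t)). Qed.

Lemma law_mult (X : Type) (t : T (T (set X))) :
  d (mmult T (set X) t) = mmult T X @` d (tmap (@d X) t).
Proof. by case: dP => _ _ /(_ X) /(congr1 (@^~ t)). Qed.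

Lemma law_bigcup (X : Type) (t : T (set (set X))) :
  d (tmap (fun AA : set (set X) => \bigcup_(A in AA) A) t)
  = \bigcup_(s in d t) d s.
Proof.
case: dP => _ _ _ /(_ X) /(congr1 (@^~ t)) /= ->.
by rewrite bigcup_image.
Qed.

Definition waction (A : algebra T) (t : T (set A)) : set A :=
  act (a := A) @` d t.
(** This is the idempotent that [splits_law] splits. *)
Definition wclosure (A : algebra T) (B : set A) : set A :=
  waction (munit T (set A) B).
Arguments waction : clear implicits.
Arguments wclosure : clear implicits.

Variable A : algebra T.

Lemma act_unit (x : A) : act (munit T A x) = x.
Proof. by case: (algebraP A). Qed.

Lemma act_mult (t : T (T A)) : act (mmult T A t) = act (tmap (act (a := A)) t).
Proof. by case: (algebraP A). Qed.

Lemma waction_hom (B : algebra T) (f : algebra_hom A B) (t : T (set A)) :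
  waction B (tmap (fun C => f @` C) t) = f @` waction A t.
Proof.
rewrite /waction law_image !image_comp; apply: eq_imagel => s _ /=.
by rewrite hom_act.
Qed.

Lemma waction_set1 (t : T A) : waction A (tmap set1 t) = [set act t].
Proof. by rewrite /waction law_set1 image_set1. Qed.

(** This is the associativity axiom of an algebra on [set A]. The unit axiom may fail: [wclosure]
    stands in place of the identity. *)
Lemma waction_mult (t : T (T (set A))) :
  waction A (mmult T (set A) t) = waction A (tmap (waction A) t).
Proof.
have -> : waction A = (fun B => act (a := A) @` B) \o @d A by [].
rewrite -tmap_comp /= law_image law_mult !image_comp.
by apply: eq_imagel => s _ /=; rewrite act_mult.
Qed.

Lemma waction_bigcup (t : T (set (set A))) :
  waction A (tmap (fun BB : set (set A) => \bigcup_(B in BB) B) t)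
  = \bigcup_(s in d t) waction A s.
Proof. by rewrite /waction law_bigcup image_bigcup. Qed.

(** This and [waction_wclosure] are [waction_mult] at an outer and at an inner unit: values of
    [waction] are closed, and [waction] does not distinguish sets from their closures. *)
Lemma wclosure_waction (t : T (set A)) :
  wclosure A (waction A t) = waction A t.
Proof. by rewrite /wclosure -tmap_unit -waction_mult mult_unit. Qed.

Lemma waction_wclosure (t : T (set A)) :
  waction A (tmap (wclosure A) t) = waction A t.
Proof.
have -> : wclosure A = waction A \o munit T (set A) by [].
by rewrite -tmap_comp -waction_mult mult_tmap_unit.
Qed.

Lemma wclosure_set1 (x : A) : wclosure A [set x] = [set x].
Proof. by rewrite /wclosure -tmap_unit waction_set1 act_unit. Qed.

(** [waction_bigcup] writes the closure of a union as a union of values of [waction]; by [law_image]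
    the inner closures move inside these, where [waction_wclosure] absorbs them. *)
Lemma wclosure_bigcup (BB : set (set A)) :
  wclosure A (\bigcup_(B in BB) wclosure A B)
  = wclosure A (\bigcup_(B in BB) B).
Proof.
rewrite -(bigcup_image BB (wclosure A) id).
rewrite /wclosure -!(tmap_unit (fun CC : set (set A) => \bigcup_(B in CC) B)).
rewrite -(tmap_unit (fun CC => wclosure A @` CC)) !waction_bigcup.
rewrite law_image bigcup_image; apply: eq_bigcupr => s _.
exact: waction_wclosure.
Qed.

End WeakAction.

Arguments waction {T} d A t.
Arguments wclosure {T} d A B.

(** * Finitely supported weights *)

Section Integral.
Variable S : pzSemiRingType.

Lemma eq_integral (X : Type) (phi : fsfunc S X) (g h : X -> S) :
  (forall x, supp phi x -> g x = h x) -> integral phi g = integral phi h.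
Proof.
by move=> gh; apply: eq_big_seq => x; rewrite mem_supp => /eqP /gh ->.
Qed.

Lemma integralMr (X : Type) (phi : fsfunc S X) (h : X -> S) (c : S) :
  integral phi (fun x => h x * c) = integral phi h * c.
Proof.
by rewrite /integral mulr_suml; apply: eq_bigr => x _; rewrite mulrA.
Qed.

Lemma integral_cst (X : Type) (phi : fsfunc S X) (c : S) :
  integral phi (fun _ => c) = total_weight phi * c.
Proof.
rewrite total_weight_integral -integralMr.
by apply: integral_ext => x; rewrite mul1r.
Qed.

Lemma integral_indicator (X : Type) (phi : fsfunc S X) (h : X -> S) (x : X) :
  integral phi (fun y => dirac_fun S y x * h y) = phi x * h x.
Proof.
rewrite -[X in X * _]integral_ev -integralMr; apply: integral_ext => y.
by rewrite /dirac_fun; case: eqP => [->|]; rewrite ?mul0r.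
Qed.

Lemma supp_smap (X Y : Type) (f : X -> Y) (phi : fsfunc S X) (y : Y) :
  supp (smap f phi) y -> exists2 x, supp phi x & f x = y.
Proof.
rewrite /supp /= smap_integral => /integral_neq0 [x sx].
by rewrite /dirac_fun; case: eqP => // <- _; exists x.
Qed.

Lemma supp_smult (X : Type) (Psi : fsfunc S (fsfunc S X)) (x : X) :
  supp (smult Psi) x -> exists2 phi, supp Psi phi & supp phi x.
Proof.
by rewrite /supp /= smult_integral => /integral_neq0 [phi]; exists phi.
Qed.

Lemma supp_dirac (X : Type) (x : X) : supp (dirac S x) `<=` [set x].
Proof. by move=> y; rewrite /supp /= /dirac_fun; case: eqP. Qed.

Lemma smap_comp (X Y Z : Type) (g : Y -> Z) (f : X -> Y) (phi : fsfunc S X) :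
  smap g (smap f phi) = smap (g \o f) phi.
Proof.
by case: (semimodule_monadP S) => -[_ /(_ _ _ _ g f) /(congr1 (@^~ phi)) /= ->].
Qed.

Lemma smap_id (X : Type) (phi : fsfunc S X) : smap id phi = phi.
Proof. by case: (semimodule_monadP S) => -[/(_ X) /(congr1 (@^~ phi))]. Qed.

Lemma eq_smap (X Y : Type) (f g : X -> Y) (phi : fsfunc S X) :
  (forall x, supp phi x -> f x = g x) -> smap f phi = smap g phi.
Proof.
move=> fg; apply: fsfunc_eq => y; rewrite /= !smap_integral.
by apply: eq_integral => x /fg ->.
Qed.

Lemma smap_dirac (X Y : Type) (f : X -> Y) (x : X) :
  smap f (dirac S x) = dirac S (f x).
Proof.
by case: (semimodule_monadP S) => _ /(_ _ _ f) /(congr1 (@^~ x)) /= <-.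
Qed.

Lemma smap_cst (X Y : Type) (y : Y) (phi : fsfunc S X) (z : Y) :
  smap (fun=> y) phi z = total_weight phi * dirac S y z.
Proof. by rewrite /= smap_integral integral_cst. Qed.

Lemma smap_smult (X Y : Type) (f : X -> Y) (Psi : fsfunc S (fsfunc S X)) :
  smap f (smult Psi) = smult (smap (smap f) Psi).
Proof.
by case: (semimodule_monadP S) => _ _ /(_ _ _ f) /(congr1 (@^~ Psi)) /= ->.
Qed.

Lemma total_weight_smap (X Y : Type) (f : X -> Y) (phi : fsfunc S X) :
  total_weight (smap f phi) = total_weight phi.
Proof. by rewrite !total_weight_integral integral_smap. Qed.

Lemma total_weight_dirac (X : Type) (x : X) : total_weight (dirac S x) = 1.
Proof. by rewrite total_weight_integral integral_dirac. Qed.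

Lemma smap_val_restrict (X : Type) (phi : fsfunc S X) :
  smap val (restrict phi) = phi.
Proof.
apply: fsfunc_eq => x; rewrite /= smap_integral.
have [phix0|phix] := pselect (phi x = 0).
- rewrite phix0; apply: contrapT => /integral_neq0 [p _].
  rewrite /dirac_fun; case: eqP => // px _.
  by have : supp phi (sval p) := set_valP p; rewrite px.
- pose p : supp phi := exist _ x (mem_set phix).
  rewrite (_ : phi x = restrict phi p) // -(integral_ev _ p).
  apply: integral_ext => q; rewrite /dirac_fun.
  case: eqP => [qx|nqx]; case: eqP => [qp|nqp] //.
  + by case: nqp; exact: (@val_inj _ _ _ q p qx).
  + by case: nqx; rewrite qp.
Qed.

Lemma smap_restrict (X Y : Type) (f : X -> Y) (phi : fsfunc S X) :
  smap (fun p : supp phi => f (val p)) (restrict phi) = smap f phi.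
Proof. by rewrite -[in RHS](smap_val_restrict phi) smap_comp. Qed.

Lemma supp_restrict (X : Type) (phi : fsfunc S X) (p : supp phi) :
  supp (restrict phi) p.
Proof. exact: (set_valP p). Qed.

(** * Scaling, binding and slicing of weights *)

Definition of_bounded (X : Type) (f : X -> S) (phi : fsfunc S X)
    (f_phi : forall x, phi x = 0 -> f x = 0) : fsfunc S X :=
  FsFunc (sub_finite_set (fun x => contra_not (f_phi x)) (fsfP phi)).

Lemma integral_inj (X : Type) (phi psi : fsfunc S X) :
  (forall h, integral phi h = integral psi h) -> phi = psi.
Proof. by move=> H; apply: fsfunc_eq => x; rewrite -!(integral_ev _ x). Qed.

Lemma integral_of_bounded (X : Type) (f : X -> S) (phi : fsfunc S X)
    (f_phi : forall x, phi x = 0 -> f x = 0) (h : X -> S) :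
  integral (of_bounded f_phi) h
  = \sum_(x <- fset_set (supp phi : set {classic X})) f x * h x.
Proof.
apply: integralE => [|x fx]; first exact: fset_uniq.
by rewrite mem_supp; apply/eqP => /f_phi.
Qed.

Lemma lscale_bounded (X : Type) (c : S) (phi : fsfunc S X) (x : X) :
  phi x = 0 -> c * phi x = 0.
Proof. by move=> ->; rewrite mulr0. Qed.

Definition lscale (X : Type) (c : S) (phi : fsfunc S X) : fsfunc S X :=
  of_bounded (@lscale_bounded X c phi).

Lemma rscale_bounded (X : Type) (c : S) (phi : fsfunc S X) (x : X) :
  phi x = 0 -> phi x * c = 0.
Proof. by move=> ->; rewrite mul0r. Qed.

Definition rscale (X : Type) (c : S) (phi : fsfunc S X) : fsfunc S X :=
  of_bounded (@rscale_bounded X c phi).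

Lemma lscaleE (X : Type) (c : S) (phi : fsfunc S X) (x : X) :
  lscale c phi x = c * phi x.
Proof. by []. Qed.

Lemma rscaleE (X : Type) (c : S) (phi : fsfunc S X) (x : X) :
  rscale c phi x = phi x * c.
Proof. by []. Qed.

Lemma integral_lscale (X : Type) (c : S) (phi : fsfunc S X) (h : X -> S) :
  integral (lscale c phi) h = c * integral phi h.
Proof.
rewrite integral_of_bounded /integral mulr_sumr.
by apply: eq_bigr => x _; rewrite mulrA.
Qed.

Lemma integral_rscale (X : Type) (c : S) (phi : fsfunc S X) (h : X -> S) :
  integral (rscale c phi) h = integral phi (fun x => c * h x).
Proof.
by rewrite integral_of_bounded; apply: eq_bigr => x _; rewrite mulrA.
Qed.

(** Kleisli extension of the semimodule monad, with [k] read as a kernel of weights. *)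
Definition bind (X Y : Type) (phi : fsfunc S X) (k : X -> fsfunc S Y) :
  fsfunc S Y := smult (smap k phi).

Lemma integral_bind (X Y : Type) (phi : fsfunc S X) (k : X -> fsfunc S Y) h :
  integral (bind phi k) h = integral phi (fun x => integral (k x) h).
Proof. by rewrite integral_smult integral_smap. Qed.

Lemma bindE (X Y : Type) (phi : fsfunc S X) (k : X -> fsfunc S Y) y :
  bind phi k y = integral phi (fun x => k x y).
Proof. by rewrite /= smult_integral integral_smap. Qed.

Lemma supp_bind (X Y : Type) (phi : fsfunc S X) (k : X -> fsfunc S Y) y :
  supp (bind phi k) y -> exists2 x, supp phi x & supp (k x) y.
Proof.
move=> y_; have [psi Hpsi kxy] := supp_smult y_.
by case: (supp_smap Hpsi) kxy => x phix <-; exists x.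
Qed.

Lemma bind_cst (X Y : Type) (phi : fsfunc S X) (psi : fsfunc S Y) :
  total_weight phi = 1 -> bind phi (fun=> psi) = psi.
Proof.
by move=> phi1; apply: fsfunc_eq => y; rewrite bindE integral_cst phi1 mul1r.
Qed.

Lemma smap_bind (X Y Z : Type) (f : Y -> Z) (phi : fsfunc S X)
    (k : X -> fsfunc S Y) :
  smap f (bind phi k) = bind phi (fun x => smap f (k x)).
Proof. by rewrite /bind smap_smult smap_comp. Qed.

Lemma bind_smap (X Y Z : Type) (f : X -> Y) (phi : fsfunc S X)
    (k : Y -> fsfunc S Z) :
  bind (smap f phi) k = bind phi (k \o f).
Proof. by rewrite /bind smap_comp. Qed.

Lemma total_weight_bind (X Y : Type) (phi : fsfunc S X) (k : X -> fsfunc S Y) :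
  (forall x, supp phi x -> total_weight (k x) = 1) ->
  total_weight (bind phi k) = total_weight phi.
Proof.
move=> k1; rewrite !total_weight_integral integral_bind.
by apply: eq_integral => x /k1; rewrite total_weight_integral.
Qed.

Lemma dirac_pair (X Y : Type) (x x' : X) (y y' : Y) :
  dirac_fun S (x, y) (x', y') = dirac_fun S x x' * dirac_fun S y y'.
Proof.
rewrite /dirac_fun; case: eqP => [[-> ->]|xy]; first by rewrite !eqxx mulr1.
case: eqP => [xx|]; last by rewrite mul0r.
by case: eqP => [yy|]; [case: xy; rewrite xx yy|rewrite mulr0].
Qed.

Lemma smap_pair (X Y : Type) (x x' : X) (phi : fsfunc S Y) (y : Y) :
  smap (pair x) phi (x', y) = dirac_fun S x x' * phi y.
Proof.
rewrite /= smap_integral -[phi y]integral_ev.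
rewrite (eq_integral (fun y' _ => dirac_pair x x' y' y)).
rewrite /dirac_fun; case: eqP => _; last first.
  by rewrite mul0r /integral big1 // => z _; rewrite mul0r mulr0.
by rewrite mul1r; apply: integral_ext => z; rewrite mul1r.
Qed.

Lemma fiber_bounded (X Y : Type) (w : fsfunc S (X * Y)) (x : X) p :
  w p = 0 -> dirac_fun S p.1 x * w p = 0.
Proof. by move=> ->; rewrite mulr0. Qed.

(** The row w(x,-), built as a pushforward so that its finite support comes for free; [sliceE]
    recovers the formula. *)
Definition slice (X Y : Type) (w : fsfunc S (X * Y)) (x : X) : fsfunc S Y :=
  smap snd (of_bounded (@fiber_bounded X Y w x)).

Lemma integral_slice (X Y : Type) (w : fsfunc S (X * Y)) (x : X) (h : Y -> S) :
  integral (slice w x) h = integral w (fun p => dirac_fun S p.1 x * h p.2).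
Proof.
rewrite integral_smap integral_of_bounded; apply: eq_bigr => p _.
by rewrite /dirac_fun; case: eqP => _; rewrite ?mul0r ?mulr0 ?mul0r ?mul1r.
Qed.

Lemma sliceE (X Y : Type) (w : fsfunc S (X * Y)) (x : X) (y : Y) :
  slice w x y = w (x, y).
Proof.
rewrite -(integral_ev _ y) integral_slice -(integral_ev w).
by apply: integral_ext => -[x' y']; rewrite dirac_pair.
Qed.

Lemma total_weight_slice (X Y : Type) (w : fsfunc S (X * Y)) (x : X) :
  total_weight (slice w x) = smap fst w x.
Proof.
rewrite total_weight_integral integral_slice /= smap_integral.
by apply: integral_ext => p; rewrite mulr1.
Qed.

(* The product distribution of the [p i], built one coordinate at a time so
   that no commutativity of S is needed. *)
Lemma independent_coupling (I X : Type) (p : I -> fsfunc S X)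
    (Q : I -> X -> Prop) (u0 : I -> X) (L : seq {classic I}) :
  (forall i, total_weight (p i) = 1) -> (forall i, supp (p i) `<=` Q i) ->
  (forall i, Q i (u0 i)) ->
  exists Th : fsfunc S (I -> X),
    [/\ total_weight Th = 1,
        supp Th `<=` [set u | forall i, Q i (u i)]
      & forall i : {classic I}, i \in L -> smap (@^~ i) Th = p i].
Proof.
move=> p1 pQ Qu0; elim: L => [|i L [Th [Th1 ThQ ThL]]].
  exists (dirac S u0); split=> //; first exact: total_weight_dirac.
  by move=> u u_ /=; rewrite (supp_dirac u_).
pose upd (u : I -> X) (x : X) (j : I) :=
  if (j : {classic I}) == i then x else u j.
(* Draw [u] from [Th], then overwrite its coordinate [i] by a fresh sample of [p i]; a coordinate
   already in [L] may be overwritten harmlessly. *)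
exists (bind Th (fun u => smap (upd u) (p i))); split.
- by rewrite total_weight_bind // => u _; rewrite total_weight_smap.
- move=> v v_; have [u /ThQ Qu v_u] := supp_bind v_.
  have [x /pQ Qx <-] := supp_smap v_u => j.
  by rewrite /upd; case: eqP => [->|].
- move=> j jL; rewrite smap_bind; under eq_fun do rewrite smap_comp /comp /upd.
  move: jL; rewrite inE; case: eqP => [-> _|_ /= /ThL <-].
    by rewrite bind_cst // smap_id.
  (* For [j] other than [i] the fresh sample is ignored and contributes only its total weight 1. *)
  apply: fsfunc_eq => x; rewrite bindE [RHS]smap_integral.
  by apply: integral_ext => u; rewrite smap_cst p1 mul1r.
Qed.

(* The Barr extension of the semimodule monad to relations. *)
Definition barr (X Y : Type) (R : X -> Y -> Prop) (s : fsfunc S X)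
    (t : fsfunc S Y) : Prop :=
  exists w : fsfunc S (X * Y),
    [/\ supp w `<=` [set p | R p.1 p.2], smap fst w = s & smap snd w = t].

Lemma barr_map (I X Y : Type) (R : X -> Y -> Prop) (f : I -> X) (g : I -> Y)
    (phi : fsfunc S I) :
  (forall i, supp phi i -> R (f i) (g i)) -> barr R (smap f phi) (smap g phi).
Proof.
move=> fRg; exists (smap (fun i => (f i, g i)) phi); split.
- by move=> p p_; have [i /fRg ? <-] := supp_smap p_.
- by rewrite smap_comp.
- by rewrite smap_comp.
Qed.

Lemma barr_bind (I X Y : Type) (R : X -> Y -> Prop) (phi : fsfunc S I)
    (f : I -> fsfunc S X) (g : I -> fsfunc S Y) :
  (forall i, supp phi i -> barr R (f i) (g i)) ->
  barr R (bind phi f) (bind phi g).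
Proof.
move=> fRg.
(* Couplings are available only over the support of [phi], so they are chosen there and [phi] is
   replaced by its restriction. *)
have /boolp.choice [W W_] (i : supp phi) :
    exists w : fsfunc S (X * Y), [/\ supp w `<=` [set p | R p.1 p.2],
      smap fst w = f (sval i) & smap snd w = g (sval i)].
  exact: fRg (set_valP i).
have bind_restrict (Z : Type) (h : I -> fsfunc S Z) :
    bind phi h = bind (restrict phi) (h \o sval).
  by rewrite -{1}[phi]smap_val_restrict /bind smap_comp.
exists (bind (restrict phi) W); split.
- by move=> p p_; have [i _] := supp_bind p_; case: (W_ i) => + _ _; exact.
- rewrite smap_bind bind_restrict; congr bind; apply/funext => i /=.
  by case: (W_ i).
- rewrite smap_bind bind_restrict; congr bind; apply/funext => i /=.
  by case: (W_ i).
Qed.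

Lemma choices_barr (X : Type) (Phi : fsfunc S (set X)) (phi : fsfunc S X) :
  choices Phi phi -> barr (@membership X) Phi phi.
Proof.
move=> [u uA ->]; rewrite -{1}[Phi]smap_val_restrict.
by apply: barr_map => A _; exact: uA.
Qed.

Lemma delta_barr (X : Type) (Phi : fsfunc S (set X)) :
  delta Phi `<=` [set phi | barr (@membership X) Phi phi].
Proof.
move=> _ [Th [Thc Th1] <-] /=.
(* As [Th] has total weight 1, [Phi] is the [Th]-average of the constant [Phi], and [barr_bind]
   averages the couplings given by the choice functions. *)
rewrite -(bind_cst Phi Th1) -[Th in smult Th]smap_id.
by apply: barr_bind => phi /Thc; exact: choices_barr.
Qed.

Lemma barr_graph (X Y : Type) (f : X -> Y) :
  barr (graph f) = graph (smap f).
Proof.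
apply/funext => s; apply/funext => t; apply/propext.
split=> [[w [wf <- <-]]|<-].
- by rewrite /graph smap_comp; apply: eq_smap => p /wf.
- by rewrite -{1}[s]smap_id; apply: barr_map.
Qed.

Lemma barr_le (X Y : Type) (R Q : X -> Y -> Prop) :
  (forall x y, R x y -> Q x y) ->
  forall s t, barr R s t -> barr Q s t.
Proof. by move=> RQ s t [w [wR ws wt]]; exists w; split=> // p /wR /RQ. Qed.

(* Every relation R is the composite of the converse of a function with a
   function, so a locally monotone extension is determined by [ext_span]. *)
Lemma ext_barr
    (E : forall X Y : Type,
           (X -> Y -> Prop) -> fsfunc S X -> fsfunc S Y -> Prop) :
  locally_monotone_extension (T := Semimod S) E -> @barr = E.
Proof.
move=> extE; apply: functional_extensionality_dep => X.
apply: functional_extensionality_dep => Y; apply/funext => R.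
apply/funext => s; apply/funext => t; apply/propext; split.
- move=> [w [wR <- <-]].
  (* The pairs that carry weight form a span inside [R]; for the converse, the span of all pairs in
     [R] is used. *)
  pose p (z : supp w) := (val z).1; pose q (z : supp w) := (val z).2.
  apply: (ext_le extE (R := rel_comp (fun x z => p z = x) (graph q))).
    by move=> _ _ [z <- <-]; exact: wR (set_valP z).
  apply/(ext_span extE (T := Semimod S)); exists (restrict w).
  + exact: (smap_restrict fst).
  + exact: (smap_restrict snd).
- pose p (z : {z : X * Y | R z.1 z.2}) := (sval z).1.
  pose q (z : {z : X * Y | R z.1 z.2}) := (sval z).2.
  move/(ext_le extE (Q := rel_comp (fun x z => p z = x) (graph q))) => H.
  have {H} /(ext_span extE (T := Semimod S)) [w <- <-] :
      E _ _ (rel_comp (fun x z => p z = x) (graph q)) s t.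
    by apply: H => x y Rxy; exists (exist _ (x, y) Rxy).
  by apply: barr_map => z _; exact: svalP z.
Qed.

End Integral.

(** * Positive semifields *)

Section PositiveSemifield.
Variable S : pzSemiRingType.
Hypotheses (S_positive : positive_semiring S) (S_semifield : semifield S).

Lemma positive_sum (I : eqType) (r : seq I) (F : I -> S) :
  \sum_(i <- r) F i = 0 -> forall i, i \in r -> F i = 0.
Proof.
elim: r => // j r IHr; rewrite big_cons => /S_positive [Fj0 /IHr Fr0] i.
by rewrite inE => /predU1P [->|/Fr0].
Qed.

(** Positivity enters here: weights cannot cancel, so [smap] and [smult] lose no support. *)
Lemma integral_eq0 (X : Type) (phi : fsfunc S X) (h : X -> S) :
  integral phi h = 0 -> forall x, phi x * h x = 0.
Proof.
move=> int0 x; have [->|phix] := eqVneq (phi x) 0; first by rewrite mul0r.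
exact: (positive_sum int0 (i := x : {classic X})) (etrans (mem_supp _ _) phix).
Qed.

Lemma inverse_fun :
  {i : S -> S & forall a, a <> 0 -> a * i a = 1 /\ i a * a = 1}.
Proof.
apply: (boolp.choice (P := fun a b => a <> 0 -> a * b = 1 /\ b * a = 1)) => a.
by have [->|/S_semifield [b ab]] := pselect (a = 0); [exists 0|exists b].
Qed.

Definition sinv : S -> S := projT1 inverse_fun.

Lemma mul_inv a : a <> 0 -> a * sinv a = 1.
Proof. by move=> /(projT2 inverse_fun) []. Qed.

Lemma inv_mul a : a <> 0 -> sinv a * a = 1.
Proof. by move=> /(projT2 inverse_fun) []. Qed.

Lemma semifield_domain (a b : S) : a * b = 0 -> a <> 0 -> b = 0.
Proof. by move=> ab0 /inv_mul a1; rewrite -[b]mul1r -a1 -mulrA ab0 mulr0. Qed.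

Lemma smap_neq0 (X Y : Type) (f : X -> Y) (phi : fsfunc S X) (x : X) :
  supp phi x -> supp (smap f phi) (f x).
Proof.
apply: contra_not; rewrite /= smap_integral => /integral_eq0 /(_ x).
by rewrite /dirac_fun eqxx mulr1.
Qed.

Lemma smult_neq0 (X : Type) (Psi : fsfunc S (fsfunc S X)) (phi : fsfunc S X) x :
  supp Psi phi -> supp phi x -> supp (smult Psi) x.
Proof.
move=> Psi_phi; apply: contra_not; rewrite /= smult_integral.
by move=> /integral_eq0 /(_ phi) /semifield_domain; exact.
Qed.

(** The conditional distribution given [x]. The inverse is on the left, so that it cancels against
    the weight of [x] in [bindE]. *)
Definition cond (X Y : Type) (w : fsfunc S (X * Y)) (x : X) : fsfunc S Y :=
  lscale (sinv (smap fst w x)) (slice w x).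

Lemma total_weight_cond (X Y : Type) (w : fsfunc S (X * Y)) (x : X) :
  smap fst w x <> 0 -> total_weight (cond w x) = 1.
Proof.
move=> wx; rewrite total_weight_integral integral_lscale.
by rewrite -total_weight_integral total_weight_slice inv_mul.
Qed.

Lemma supp_cond (X Y : Type) (w : fsfunc S (X * Y)) (x : X) (y : Y) :
  supp (cond w x) y -> supp w (x, y).
Proof.
by apply: contra_not; rewrite /cond lscaleE sliceE => ->; rewrite mulr0.
Qed.

(** Disintegration: where the first marginal is nonzero the inverse cancels, and where it vanishes
    so does [w], by [smap_neq0]. *)
Lemma bind_cond (X Y : Type) (w : fsfunc S (X * Y)) :
  bind (smap fst w) (fun x => smap (pair x) (cond w x)) = w.
Proof.
apply: fsfunc_eq => -[x y]; rewrite bindE.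
under integral_ext => x' do rewrite smap_pair.
rewrite integral_indicator.
have [wx0|wx] := pselect (smap fst w x = 0); last first.
  by rewrite /cond lscaleE sliceE mulrA mul_inv // mul1r.
rewrite wx0 mul0r; apply: contrapT => /nesym wxy.
exact: (smap_neq0 (f := fst) (phi := w) (x := (x, y)) wxy wx0).
Qed.

Lemma smap_snd_cond (X Y : Type) (w : fsfunc S (X * Y)) :
  smap snd w = bind (smap fst w) (cond w).
Proof.
rewrite -{1}[w]bind_cond smap_bind; congr bind; apply/funext => x.
by rewrite smap_comp smap_id.
Qed.

Lemma smap_fst_bind_cond (X Y I : Type) (w : fsfunc S (X * Y))
    (phi : fsfunc S I) (f : I -> X) :
  (forall i, supp phi i -> smap fst w (f i) <> 0) ->
  smap fst (bind phi (fun i => smap (pair i) (cond w (f i)))) = phi.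
Proof.
move=> phi_w; apply: integral_inj => h; rewrite smap_bind integral_bind.
apply: eq_integral => i /phi_w wi.
rewrite smap_comp integral_smap (integral_cst _ (h i)).
by rewrite total_weight_cond // mul1r.
Qed.

Lemma barr_comp (X Y Z : Type) (R : X -> Y -> Prop) (Q : Y -> Z -> Prop) :
  barr (S := S) (rel_comp R Q) = rel_comp (barr R) (barr Q).
Proof.
apply/funext => s; apply/funext => t; apply/propext; split.
- move=> [w [wRQ <- <-]].
  have /boolp.choice [y y_] (p : supp w) :
      exists y, R (val p).1 y /\ Q y (val p).2.
    by have [y] := wRQ _ (set_valP p); exists y.
  exists (smap y (restrict w)).
  + rewrite -(smap_restrict fst).
    by apply: barr_map => p _; case: (y_ p).
  + rewrite -(smap_restrict snd).
    by apply: barr_map => p _; case: (y_ p).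
- move=> [_ [w1 [w1R <- <-]] [w2 [w2Q w21 <-]]].
  (* Gluing along the common marginal on [Y]: given [y], the third coordinate is drawn from [w2]
     independently of [x]. *)
  pose w := bind w1 (fun p => smap (pair p) (cond w2 p.2)).
  have ws1 : smap fst w = w1.
    by apply: smap_fst_bind_cond => p w1p; rewrite w21; exact: smap_neq0.
  have ws2 : smap (fun p => (p.1.2, p.2)) w = w2.
    rewrite smap_bind -[RHS]bind_cond w21 bind_smap; congr bind.
    by apply/funext => p; rewrite smap_comp.
  rewrite -ws1 -ws2 !smap_comp; apply: barr_map => -[[x y] z] wxyz.
  (* A triple carrying weight in [w] projects to pairs carrying weight in [w1] and [w2], since
     nothing cancels. *)
  exists y.
  + apply: (w1R (x, y)); rewrite -ws1.
    exact: (smap_neq0 (f := fst) (x := (x, y, z)) wxyz).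
  + apply: (w2Q (y, z)); rewrite -ws2.
    exact: (smap_neq0 (f := fun p => (p.1.2, p.2))
      (x := (x, y, z)) wxyz).
Qed.

Lemma barr_mult (X Y : Type) (R : X -> Y -> Prop) :
  rel_comp (barr (barr (S := S) R)) (graph (@smult S Y))
  = rel_comp (graph (@smult S X)) (barr R).
Proof.
apply/funext => Phi; apply/funext => t; apply/propext; split.
- move=> [_ [W [WR <- <-]] <-]; exists (smult (smap fst W)) => //.
  exact: barr_bind.
- move=> [_ <- [v [vR vPhi <-]]].
  (* Every [phi] in the support of [Phi] gets the conditional weights of [v]; these couplings have
     first marginal [phi] and average to [v]. *)
  pose k (phi : fsfunc S X) :=
    bind phi (fun x => smap (pair x) (cond v x)).
  have kmult : smult (smap k Phi) = v.
    apply: integral_inj => h; rewrite -[in RHS](bind_cond v) vPhi.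
    rewrite integral_bind !integral_smult integral_smap.
    by apply: integral_ext => phi; rewrite integral_bind.
  exists (smap (fun phi => smap snd (k phi)) Phi).
    rewrite -{1}[Phi]smap_id; apply: barr_map => phi Phi_phi.
    exists (k phi); split=> //.
    + move=> [x y] kxy; apply: (vR (x, y)); rewrite -kmult.
      by apply: smult_neq0 kxy => //; exact: smap_neq0.
    + apply: smap_fst_bind_cond => x phix; rewrite vPhi.
      exact: smult_neq0 phix.
  by rewrite /graph -smap_comp -smap_smult kmult.
Qed.

Lemma barr_extension : locally_monotone_extension (T := Semimod S) (@barr S).
Proof.
split.
- exact: barr_graph.
- exact: barr_comp.
- exact: barr_le.
- exact: barr_mult.
Qed.

Lemma barr_delta (X : Type) (Phi : fsfunc S (set X)) (phi : fsfunc S X) :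
  barr (@membership X) Phi phi -> delta Phi phi.
Proof.
move=> [w [w_mem wPhi <-]].
(* Unlike in [cond], the inverse is on the right: in the average over [Th] below, the factor
   [Phi (val A)] stands to the right of the weights of [Th]. *)
pose p (A : supp Phi) :=
  rscale (sinv (Phi (val A))) (slice w (val A)).
have p1 A : total_weight (p A) = 1.
  rewrite total_weight_integral integral_rscale integral_cst.
  by rewrite total_weight_slice wPhi mulr1 mul_inv //; exact: set_valP A.
have p_mem (A : supp Phi) x : supp (p A) x -> (val A) x.
  move=> px; apply: (w_mem (val A, x)); apply: contra_not px.
  by rewrite /p rscaleE sliceE => ->; rewrite mul0r.
have /boolp.choice [u0 u0_mem] (A : supp Phi) : exists x, (val A) x.
  have : smap fst w (val A) <> 0 by rewrite wPhi; exact: set_valP A.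
  rewrite /= smap_integral => /integral_neq0 [q /w_mem qmem].
  by rewrite /dirac_fun; case: eqP => // qA _; exists q.2; rewrite -qA.
pose L : seq {classic supp Phi} :=
  fset_set (supp (restrict Phi) : set {classic supp Phi}).
have LT (A : {classic supp Phi}) : A \in L.
  by rewrite mem_supp; apply/eqP; exact: supp_restrict.
(* A random choice function whose value at [A] is distributed as [p A]. *)
have [Th [Th1 Th_mem Thp]] := independent_coupling L p1 p_mem u0_mem.
pose c (u : supp Phi -> X) := smap u (restrict Phi).
exists (smap c Th); first split.
- move=> _ /(@supp_smap _ _ _ c) [u /Th_mem u_mem <-].
  by exists u.
- by rewrite total_weight_smap.
apply: fsfunc_eq => x; rewrite -/(bind Th c) bindE [RHS]smap_integral.
have step (u : supp Phi -> X) :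
    c u x = \sum_(A <- L) dirac_fun S (u A) x * Phi (val A).
  rewrite /c /= smap_integral; apply: eq_bigr => A _.
  by rewrite /dirac_fun; case: eqP; rewrite ?(mulr0, mul0r, mulr1, mul1r).
rewrite (integral_ext _ step) /integral.
under eq_bigr do rewrite mulr_sumr.
rewrite exchange_big /=.
have marg (A : {classic supp Phi}) :
    integral Th (fun u => dirac_fun S (u A) x * Phi (val A)) = w (val A, x).
  rewrite integralMr.
  have -> : integral Th (fun u => dirac_fun S (u A) x) = p A x.
    by rewrite -Thp // [RHS]smap_integral.
  rewrite /p rscaleE sliceE.
  by rewrite -mulrA inv_mul ?mulr1 //; exact: set_valP A.
under eq_bigr => A _ do rewrite -/(integral _ _) marg -integral_ev.
rewrite /integral exchange_big /= big_seq [RHS]big_seq; apply: eq_bigr => q.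
rewrite mem_supp => /eqP wq.
(* Both sides are now sums over the support of [w]; on the left, only the set [q.1] contributes to
   the inner sum over [L]. *)
have Phiq : Phi q.1 <> 0 by rewrite -wPhi; exact: smap_neq0.
pose A0 : supp Phi := exist _ q.1 (mem_set Phiq).
rewrite -mulr_sumr; congr (_ * _).
rewrite -[RHS](@sum_dirac _ _ L A0 (fun=> _)) //.
  apply: eq_bigr => A _; rewrite {1}(surjective_pairing q) dirac_pair.
  congr (_ * _); rewrite /dirac_fun.
  case: eqP => [qA|nqA]; case: eqP => [AA|nAA] //.
  + by case: nAA; exact: (@val_inj _ _ _ A0 A qA).
  + by case: nqA; rewrite -AA.
exact: fset_uniq.
Qed.

Lemma deltaE (X : Type) :
  @delta S X = fun Phi => [set phi | barr (@membership X) Phi phi].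
Proof.
apply/funext => Phi; apply/seteqP; split=> phi.
- exact: delta_barr.
- exact: barr_delta.
Qed.

Lemma delta_canonical : canonical_law (T := Semimod S) (@delta S).
Proof.
exists (@barr S); split; last by move=> X Phi; rewrite deltaE.
by split=> [|E /ext_barr //]; exact: barr_extension.
Qed.

Lemma delta_weak_law :
  weak_distributive_law (T := Semimod S) (P := Powerset) (@delta S).
Proof.
rewrite (_ : @delta S = @law_of_ext (Semimod S) (@barr S)).
  exact/weak_law_of_ext/barr_extension.
by apply: functional_extensionality_dep => X; rewrite deltaE.
Qed.

(** * The weak lifting *)

Notation daction := (waction (T := Semimod S) (@delta S)).
Notation dclosure := (wclosure (T := Semimod S) (@delta S)).

(** A coupling of the Dirac weight at [B] with [phi] inside membership exists exactly when [phi] is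
    supported in [B] and has total weight 1. *)
Lemma convex_closureE (X : EMcat (Semimod S)) :
  convex_closure (act (a := X)) = dclosure X.
Proof.
apply/funext => B; rewrite /wclosure /waction deltaE.
congr image; apply/seteqP; split=> phi.
- move=> [phiB phi1]; rewrite -[phi]smap_id.
  have -> : munit (Semimod S) (set X) B = smap (fun=> B) phi.
    by apply: fsfunc_eq => C; rewrite smap_cst phi1 mul1r.
  by apply: barr_map => x /phiB.
- move=> [w [w_mem wB <-]]; split.
  + move=> x wx; have [p wp <-] := supp_smap wx.
    have := w_mem _ wp; rewrite /membership /=.
    have := smap_neq0 (f := fst) wp.
    by rewrite wB => pB; rewrite (supp_dirac pB).
  + by rewrite total_weight_smap -(total_weight_smap fst) wB total_weight_dirac.
Qed.

(* When every set in supp Phi is convex, replacing the conditional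
   distribution of w over each set by its barycentre gives a choice function
   with the same image. *)
Lemma daction_choices (X : EMcat (Semimod S)) (Phi : fsfunc S (set X)) :
  (forall B, supp Phi B -> B = convex_closure (act (a := X)) B) ->
  daction X Phi = [set act (a := X) phi | phi in choices Phi].
Proof.
move=> Phi_convex; rewrite /waction deltaE; apply/seteqP; split; last first.
  by move=> _ [phi /choices_barr Phi_phi <-]; exists phi.
move=> _ [_ [w [w_mem wPhi <-]] <-].
pose u (B : set X) := act (a := X) (cond w B).
have u_mem (B : supp Phi) : (val B) (u (val B)).
  have := set_valP B => PhiB.
  rewrite [X in X (u _)](Phi_convex _ PhiB).
  exists (cond w (val B)) => //.
  split; first by move=> x x_ /=; exact: w_mem _ (supp_cond x_).
  by rewrite total_weight_cond // wPhi.
exists (smap u Phi).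
  by exists (fun B => u (val B)) => //; rewrite smap_restrict.
rewrite smap_snd_cond // wPhi /bind.
have /= <- := (algebraP X).2 (smap (cond w) Phi).
by rewrite smap_comp.
Qed.

Lemma incl_inj (X : EMcat (Semimod S)) : injective (incl (X := X)).
Proof. by move=> B C; exact: val_inj. Qed.

Lemma incl_convex (X : EMcat (Semimod S)) (B : Pc X) :
  dclosure X (incl B) = incl B.
Proof. by rewrite -convex_closureE -(set_valP B). Qed.

(** Transparent, so that [incl (mkPc B_convex)] converts to [B]. *)
Definition mkPc (X : EMcat (Semimod S)) (B : set X)
    (B_convex : dclosure X B = B) : Pc X.
Proof.
by exists B; apply: mem_set; rewrite /convex_sets /= convex_closureE.
Defined.

Definition alpha (X : EMcat (Semimod S)) (Phi : fsfunc S (Pc X)) : Pc X :=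
  mkPc (wclosure_waction delta_weak_law (smap (incl (X := X)) Phi)).

Lemma incl_alpha (X : EMcat (Semimod S)) (Phi : fsfunc S (Pc X)) :
  incl (alpha Phi) = daction X (smap (incl (X := X)) Phi).
Proof. by []. Qed.

(** The unit axiom holds on [Pc X] because its members are fixed by the closure; associativity is
    inherited from [waction_mult]. *)
Lemma alphaP (X : EMcat (Semimod S)) :
  is_algebra (T := Semimod S) (@alpha X).
Proof.
split=> t; apply: incl_inj; rewrite !incl_alpha.
- by rewrite smap_dirac; exact: incl_convex.
- rewrite [mmult _ _]/= smap_smult.
  rewrite [RHS](waction_mult delta_weak_law) /tmap /= !smap_comp.
  by congr waction; apply: eq_smap => Phi _ /=; rewrite incl_alpha.
Qed.

Definition Pt (X : EMcat (Semimod S)) : EMcat (Semimod S) := Algebra (alphaP X).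

Lemma image_convex (X Y : EMcat (Semimod S)) (f : Mor X Y) (B : Pc X) :
  dclosure Y (U1 f @` incl B) = U1 f @` incl B.
Proof.
rewrite -{2}(incl_convex B) /wclosure -(waction_hom delta_weak_law).
by rewrite tmap_unit.
Qed.

Definition Ptm_fun (X Y : EMcat (Semimod S)) (f : Mor X Y) (B : Pt X) : Pt Y :=
  mkPc (image_convex f B).

Lemma Ptm_act (X Y : EMcat (Semimod S)) (f : Mor X Y) (Phi : Semimod S (Pt X)) :
  Ptm_fun f (act Phi)
  = act (mmap (Semimod S) (X := Pt X) (Y := Pt Y) (Ptm_fun f) Phi).
Proof.
apply: incl_inj; rewrite [LHS](esym (waction_hom delta_weak_law f _)).
by rewrite incl_alpha /tmap /= !smap_comp.
Qed.

Definition Ptm (X Y : EMcat (Semimod S)) (f : Mor X Y) : Mor (Pt X) (Pt Y) :=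
  AlgebraHom (Ptm_act f).

Definition eta_fun (X : EMcat (Semimod S)) (x : X) : Pt X :=
  mkPc (wclosure_set1 delta_weak_law x).

Lemma eta_act (X : EMcat (Semimod S)) (t : Semimod S X) :
  eta_fun (act t) = act (mmap (Semimod S) (X := X) (Y := Pt X) (@eta_fun X) t).
Proof.
apply: incl_inj; rewrite incl_alpha /= smap_comp.
exact: esym (waction_set1 delta_weak_law t).
Qed.

Definition eta (X : EMcat (Semimod S)) : Mor X (Pt X) :=
  AlgebraHom (@eta_act X).

Definition union (X : EMcat (Semimod S)) (BB : set (Pt X)) : set X :=
  \bigcup_(B in BB) incl (X := X) B.

(** Union commutes with the actions. This yields the convexity of unions of convex families, the
    homomorphism property of [mu] and the compatibility of [pi] with [mu]. *)
Lemma waction_union (X : EMcat (Semimod S)) (Om : fsfunc S (set (Pt X))) :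
  daction X (smap (@union X) Om) = union (daction (Pt X) Om).
Proof.
have -> : @union X = (fun CC => \bigcup_(C in CC) C) \o
    (fun BB : set (Pt X) => incl (X := X) @` BB).
  by apply/funext => BB; rewrite /= bigcup_image.
rewrite -smap_comp [LHS](waction_bigcup delta_weak_law).
by rewrite (law_image delta_weak_law) /= !bigcup_image.
Qed.

Lemma union_convex (X : EMcat (Semimod S)) (BB : Pc (Pt X)) :
  dclosure X (union (incl BB)) = union (incl BB).
Proof.
by rewrite -{2}(incl_convex BB) /wclosure -waction_union /= smap_dirac.
Qed.

Definition mu_fun (X : EMcat (Semimod S)) (BB : Pt (Pt X)) : Pt X :=
  mkPc (union_convex BB).

Lemma mu_act (X : EMcat (Semimod S)) (t : Semimod S (Pt (Pt X))) :
  mu_fun (act t)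
  = act (mmap (Semimod S) (X := Pt (Pt X)) (Y := Pt X) (@mu_fun X) t).
Proof.
apply: incl_inj; rewrite incl_alpha /= smap_comp.
by rewrite [LHS](esym (waction_union _)) smap_comp.
Qed.

Definition mu (X : EMcat (Semimod S)) : Mor (Pt (Pt X)) (Pt X) :=
  AlgebraHom (@mu_act X).

Lemma wclosure_idem (X : EMcat (Semimod S)) (B : set X) :
  dclosure X
    (dclosure X B)
  = dclosure X B.
Proof. exact: (wclosure_waction delta_weak_law). Qed.

Definition pi (X : EMcat (Semimod S)) (B : set X) : Pc X :=
  mkPc (wclosure_idem B).

Lemma incl_pi (X : EMcat (Semimod S)) (B : set X) :
  incl (pi B) = dclosure X B.
Proof. by []. Qed.

Lemma hom_incl_eq (X Y : EMcat (Semimod S)) (f g : Mor X (Pt Y)) :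
  (forall x, incl (X := Y) (U1 f x) = incl (X := Y) (U1 g x)) -> f = g.
Proof.
by move=> fg; apply/algebra_hom_eq/funext => x; exact/incl_inj/fg.
Qed.

Lemma Pt_monad : is_monad Ptm eta mu.
Proof.
split; [split| | |split|].
- by move=> X; apply: hom_incl_eq => B; exact: image_id.
- move=> X Y Z g f; apply: hom_incl_eq => B; exact: esym (image_comp _ _ _).
- move=> X Y f; apply: hom_incl_eq => x; exact: esym (image_set1 _ _).
- move=> X Y f; apply: hom_incl_eq => BB.
  by rewrite [LHS]bigcup_image [RHS]image_bigcup.
- by move=> X; apply: hom_incl_eq => B; exact: bigcup_set1.
- move=> X; apply: hom_incl_eq => B.
  rewrite [LHS]bigcup_image; apply/seteqP.
  by split=> [y [x Bx ->]|y By]; last exists y.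
- move=> X; apply: hom_incl_eq => BBB.
  by rewrite [LHS]bigcup_image [RHS]bigcup_bigcup.
Qed.

Lemma Pt_weak_lifting :
  is_weak_lifting (P := Powerset) (Qo := Pt) Ptm eta mu (@incl S) pi.
Proof.
split; [exact: Pt_monad|split| |split|split].
- by [].
- move=> X Y f; apply/funext => B; apply: incl_inj.
  by rewrite [RHS](esym (waction_hom delta_weak_law f _)) tmap_unit.
- by move=> X; apply/funext => B; apply/incl_inj/incl_convex.
- by [].
- by move=> X; apply/funext => BB; rewrite /= bigcup_image.
- by move=> X; apply/funext => x; apply/incl_inj/(wclosure_set1 delta_weak_law).
- move=> X; apply/funext => BB; apply: incl_inj.
  rewrite [RHS](esym (waction_union _)) /= smap_dirac /union bigcup_image.
  exact: esym (wclosure_bigcup delta_weak_law BB).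
Qed.

Lemma Pt_splits_law :
  splits_law (P := Powerset) (Qo := Pt) (@incl S) pi (@delta S).
Proof.
move=> X; split=> //; apply/funext => Phi; apply: incl_inj.
exact: esym (wclosure_waction delta_weak_law _).
Qed.

(** The closures introduced by [pi] are absorbed by [waction_wclosure]; what remains is [law_image]
    and the right unit law of the semimodule monad. *)
Lemma Pt_induces_law :
  induces_law (P := Powerset) (Qo := Pt) (@incl S) pi (@delta S).
Proof.
move=> X F; apply/funext => Phi /=; rewrite incl_alpha !smap_comp.
rewrite -(smap_comp (dclosure F) (fun B : set X => @dirac S X @` B)).
rewrite [RHS](waction_wclosure delta_weak_law) /waction.
rewrite (law_image delta_weak_law) image_comp.
apply/esym/eq_image_id => phi _.
exact: (mult_tmap_unit (T := Semimod S) phi).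
Qed.

End PositiveSemifield.

Theorem theorem4p1 (S : pzSemiRingType)
    (S_positive : positive_semiring S) (S_semifield : semifield S) :
  [/\ canonical_law (T := Semimod S) (@delta S),
      weak_distributive_law (T := Semimod S) (P := Powerset) (@delta S)
    & exists (alpha : forall X : EMcat (Semimod S), fsfunc S (Pc X) -> Pc X)
             (alphaP : forall X : EMcat (Semimod S),
                         is_algebra (T := Semimod S) (alpha X)),
      let Pt (X : EMcat (Semimod S)) : EMcat (Semimod S) := Algebra (alphaP X) in
      exists (Ptm : forall X Y : EMcat (Semimod S), Mor X Y -> Mor (Pt X) (Pt Y))
             (eta : forall X : EMcat (Semimod S), Mor X (Pt X))
             (mu : forall X : EMcat (Semimod S), Mor (Pt (Pt X)) (Pt X))
             (iota : forall X : EMcat (Semimod S), Pc X -> set X)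
             (pi : forall X : EMcat (Semimod S), set X -> Pc X),
        [/\ forall (X : EMcat (Semimod S)) (Phi : fsfunc S (Pc X)),
              incl (alpha X Phi)
              = [set act (a := X) phi
                | phi in choices (smap (incl (X := X)) Phi)],
            forall (X Y : EMcat (Semimod S)) (f : Mor X Y) (A : Pc X),
              incl (U1 (Ptm X Y f) A) = [set U1 f x | x in incl A],
            (forall (X : EMcat (Semimod S)) (x : U0 X),
              incl (U1 (eta X) x) = [set x]) /\
            (forall (X : EMcat (Semimod S)) (AA : Pc (Pt X)),
              incl (U1 (mu X) AA)
              = \bigcup_(A in incl AA) incl (X := X) A),
            (forall (X : EMcat (Semimod S)) (A : Pc X), iota X A = incl A) /\
            (forall (X : EMcat (Semimod S)) (B : set X),
              incl (pi X B) = convex_closure (act (a := X)) B)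
          & [/\ is_weak_lifting (P := Powerset) (Qo := Pt) Ptm eta mu iota pi,
                splits_law (P := Powerset) (Qo := Pt) iota pi (@delta S)
              & induces_law (P := Powerset) (Qo := Pt) iota pi (@delta S)]]].
Proof.
split; [exact: delta_canonical|exact: delta_weak_law|].
exists (alpha S_positive S_semifield), (alphaP S_positive S_semifield).
exists (@Ptm S S_positive S_semifield), (eta S_positive S_semifield).
exists (mu S_positive S_semifield), (@incl S), (@pi S S_positive S_semifield).
split=> //.
- move=> X Phi; rewrite incl_alpha daction_choices //.
  by move=> B PhiB; have [C _ <-] := supp_smap PhiB; exact: set_valP C.
- by split=> // X B; rewrite incl_pi convex_closureE.
split; [exact: Pt_weak_lifting|exact: Pt_splits_law|exact: Pt_induces_law].
Qed.
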